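(* Every conditional risk measure $\rho$ on $L^\phi(\mathcal{E})$ extends to a unique conditional risk measure $\bar\rho$ on $L^\phi_{\mathcal{F}}(\mathcal{E})$. Moreover, the extension $\bar\rho$ satisfies $\bar\rho^\#(y)=\rho^\#(y)$ for all $y\in L^{\phi^\ast}(\mathcal{E})$.
   Context: $(\Omega,\mathcal{E},\mathbb{P})$ is a probability space and $\mathcal{F}\subset\mathcal{E}$ a sub-$\sigma$-algebra. Random variables and sets that coincide a.s. are identified; all (in)equalities between $\mathbb{R}\cup\{\pm\infty\}$-valued random variables are in the a.s. sense. $L^0(\mathcal{E})$ and $L^0(\mathcal{F})$ are the spaces of (classes of) real-valued $\mathcal{E}$-, resp. $\mathcal{F}$-measurable random variables; $L^0_{++}(\mathcal{F})$ is the set of $\eta\in L^0(\mathcal{F})$ with $\eta>0$ a.s.; essential suprema are taken in the space $\bar L^0(\mathcal{F})$ of $\mathbb{R}\cup\{\pm\infty\}$-valued $\mathcal{F}$-measurable random variables. The conditional expectation is generalized: for $\eta\ge 0$, $\mathbb{E}[\eta|\mathcal{F}]:=\lim_n\mathbb{E}[\eta\wedge n|\mathcal{F}]$ (possibly $+\infty$), and $\mathbb{E}[\eta|\mathcal{F}]:=\mathbb{E}[\eta^+|\mathcal{F}]-\mathbb{E}[\eta^-|\mathcal{F}]$ with $+\infty-\infty=+\infty$. $\phi\colon[0,+\infty)\to[0,+\infty]$ is a Young function: increasing, left-continuous, convex, finite on a neighborhood of $0$, $\phi(0)=0$, $\lim_{x\to+\infty}\phi(x)=+\infty$. Its conjugate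 Young function is $\phi^\ast(s):=\sup_{r\ge0}\{rs-\phi(r)\}$, $s\ge 0$. For a Young function $\psi$: $L^\psi(\mathcal{E}):=\{x\in L^0(\mathcal{E}) : \exists\, r\in(0,+\infty),\ \mathbb{E}[\psi(r|x|)]<+\infty\}$ and $L^\psi_{\mathcal{F}}(\mathcal{E}):=\{x\in L^0(\mathcal{E}) : \exists\,\eta\in L^0_{++}(\mathcal{F}),\ \mathbb{E}[\psi(\eta|x|)|\mathcal{F}]\in L^0(\mathcal{F})\}$. One has $L^\psi(\mathcal{E})\subset L^\psi_{\mathcal{F}}(\mathcal{E})$. A function $\rho\colon L^\phi(\mathcal{E})\to L^0(\mathcal{F})$ is a conditional risk measure on $L^\phi(\mathcal{E})$ if it is monotone ($x\le y$ implies $\rho(x)\ge\rho(y)$), $L^\infty(\mathcal{F})$-convex ($\rho(\lambda x+(1-\lambda)y)\le\lambda\rho(x)+(1-\lambda)\rho(y)$ for $\lambda\in L^\infty(\mathcal{F})$, $0\le\lambda\le1$), and $L^\infty(\mathcal{F})$-cash invariant ($\rho(x+\eta)=\rho(x)-\eta$ for $\eta\in L^\infty(\mathcal{F})$). Its conjugate is $\rho^\#(y):=\operatorname{ess.sup}\{\mathbb{E}[xy|\mathcal{F}]-\rho(x) : x\in L^\phi(\mathcal{E})\}$, $y\in L^{\phi^\ast}(\mathcal{E})$. A function $\rho\colon L^\phi_{\mathcal{F}}(\mathcal{E})\to L^0(\mathcal{F})$ is a conditional risk measure on $L^\phi_{\mathcal{F}}(\mathcal{E})$ if it is monotone, $L^0(\mathcal{F})$-convex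 (same inequality for $\lambda\in L^0(\mathcal{F})$, $0\le\lambda\le1$), and $L^0(\mathcal{F})$-cash invariant (same identity for $\eta\in L^0(\mathcal{F})$). Its conjugate is $\rho^\#(y):=\operatorname{ess.sup}\{\mathbb{E}[xy|\mathcal{F}]-\rho(x) : x\in L^\phi_{\mathcal{F}}(\mathcal{E})\}$, $y\in L^{\phi^\ast}_{\mathcal{F}}(\mathcal{E})$. *)

(* Defs.v *)
From HB Require Import structures.
From mathcomp Require Export all_boot all_order all_algebra.
From mathcomp Require Export all_classical all_reals all_analysis.
From mathcomp Require Export measurable_realfun.
Export Order.TTheory GRing.Theory Num.Theory.
Export numFieldNormedType.Exports.

Set Implicit Arguments.
Unset Strict Implicit.
Unset Printing Implicit Defensive.

Local Open Scope classical_set_scope.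
Local Open Scope ring_scope.

(* Random variables are represented by functions on the sample space and their
   almost sure identification by the relation [= %[ae P]]; all inequalities
   between random variables below are likewise [P]-almost sure. *)

Section young.
Context {R : realType}.

(* A Young function psi : [0, +oo) -> [0, +oo] is encoded by its extension by 0
   to the negative half-line. *)
Record young_function (psi : R -> \bar R) : Prop := YoungFunction {
  young_neg : forall r, r < 0 -> psi r = 0%E ;
  young_ge0 : forall r, 0 <= r -> (0 <= psi r)%E ;
  young_nondecreasing :
    forall r s, 0 <= r -> r <= s -> (psi r <= psi s)%E ;
  young_left_continuous : forall r, 0 < r -> psi s @[s --> r^'-] --> psi r ;
  young_convex : forall (t r s : R), 0 <= t -> t <= 1 -> 0 <= r -> 0 <= s ->
    (psi (t * r + (1 - t) * s)%R <= t%:E * psi r + (1 - t)%:E * psi s)%E ;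
  young_finite_near0 :
    exists2 e : R, 0 < e & forall r, 0 <= r -> r < e -> (psi r < +oo)%E ;
  young0 : psi 0 = 0%E ;
  young_cvgy : psi s @[s --> +oo%R] --> +oo%E }.

(* For s < 0 and psi a Young function this is 0, in accordance with the encoding
   above. *)
Definition young_conjugate (psi : R -> \bar R) (s : R) : \bar R :=
  ereal_sup [set ((r * s)%:E - psi r)%E | r in [set r : R | 0 <= r]].

End young.

Section conditional.
Context {R : realType} {d : measure_display} {T : measurableType d}.
Variables (P : probability T R) (F : set (set T)).

(* When F is a sigma-algebra, the measurable sets of [g_sigma_algebraType F] are
   exactly the elements of F. *)
Definition F_measurable {d'} {U : measurableType d'} (f : T -> U) : Prop :=
  measurable_fun [set: g_sigma_algebraType F] (f : g_sigma_algebraType F -> U).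

Definition L0 : set (T -> R) := [set x | measurable_fun setT x].

Definition L0F : set (T -> R) := [set x | F_measurable x].

Definition L0F_pp : set (T -> R) :=
  [set eta | L0F eta /\ \forall w \ae P, 0 < eta w].

Definition LinftyF : set (T -> R) :=
  [set eta | L0F eta /\ eta \in Lfun P +oo%E].

Definition is_cond_exp (f g : T -> \bar R) : Prop :=
  [/\ F_measurable g, P.-integrable setT g &
      forall A, F A -> (\int[P]_(w in A) g w = \int[P]_(w in A) f w)%E].

(* Some version of the conditional expectation of an integrable function. *)
Definition cond_exp1 (f : T -> \bar R) : T -> \bar R :=
  xget (cst 0%E) [set g | is_cond_exp f g].

(* For measurable f >= 0 the truncated conditional expectations are almost surely
   nondecreasing in n, so this pointwise limit exists almost surely. *)
Definition cond_exp_nneg (f : T -> \bar R) (w : T) : \bar R :=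
  limn (fun n : nat => cond_exp1 (fun v => mine (f v) n%:R%:E) w).

(* The addition [%dE] implements the convention +oo - oo = +oo. *)
Definition cond_exp (f : T -> \bar R) (w : T) : \bar R :=
  (cond_exp_nneg (f^\+)%E w - cond_exp_nneg (f^\-)%E w)%dE.

Definition orlicz (psi : R -> \bar R) : set (T -> R) :=
  [set x | L0 x /\
    exists2 r : R, 0 < r & (\int[P]_w psi (r * `|x w|)%R < +oo)%E].

Definition cond_orlicz (psi : R -> \bar R) : set (T -> R) :=
  [set x | L0 x /\
    exists eta z : T -> R, [/\ L0F_pp eta, L0F z &
      cond_exp (fun w => psi (eta w * `|x w|)) = (fun w => (z w)%:E)
        %[ae P]]].

(* Conditional risk measures with domain X, where C is the set of coefficients
   for convexity and cash invariance; the values of rho outside X are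
   irrelevant. *)
Record cond_risk_measure (X C : set (T -> R)) (rho : (T -> R) -> (T -> R)) :
    Prop := CondRiskMeasure {
  crm_L0F : forall x, X x -> L0F (rho x) ;
  crm_class : forall x y, X x -> X y ->
    x = y %[ae P] -> rho x = rho y %[ae P] ;
  crm_monotone : forall x y, X x -> X y ->
    (\forall w \ae P, x w <= y w) -> \forall w \ae P, rho y w <= rho x w ;
  crm_convex : forall x y lam, X x -> X y -> C lam ->
    (\forall w \ae P, 0 <= lam w <= 1) ->
    \forall w \ae P, rho (fun v => lam v * x v + (1 - lam v) * y v) w <=
                     lam w * rho x w + (1 - lam w) * rho y w ;
  crm_cash_invariant : forall x eta, X x -> C eta ->
    rho (fun v => x v + eta v) = (fun w => rho x w - eta w) %[ae P] }.

Definition is_ess_sup_family (S : set (T -> \bar R)) (g : T -> \bar R) : Prop :=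
  [/\ F_measurable g,
      forall f, S f -> \forall w \ae P, (f w <= g w)%E &
      forall h, F_measurable h ->
        (forall f, S f -> \forall w \ae P, (f w <= h w)%E) ->
        \forall w \ae P, (g w <= h w)%E].

Definition ess_sup_family (S : set (T -> \bar R)) : T -> \bar R :=
  xget (cst 0%E) [set g | is_ess_sup_family S g].

Definition crm_conjugate (X : set (T -> R)) (rho : (T -> R) -> (T -> R))
    (y : T -> R) : T -> \bar R :=
  ess_sup_family
    [set (fun w => cond_exp (fun v => (x v * y v)%:E) w - (rho x w)%:E)%E
      | x in X].

End conditional.

(* Main.v *)
Require Import Defs.
From mathcomp Require Import lra.

Set Implicit Arguments.
Unset Strict Implicit.
Unset Printing Implicit Defensive.

(** Convexity with the coefficients [\1_A], [A] in [F], makes a conditional risk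
    measure local: [rho x = rho y] a.s. on [A] as soon as [x = y] on [A].
    An [x] in the conditional Orlicz space is locally in the Orlicz space: if
    [E[phi (eta |x|) | F] = z], then [\1_(A n) * x] is in it for
    [A n = {z <= n} `&` {1 / (n + 1) <= eta}], and almost every point is eventually
    in [A n]. The value of the extension at [x] on [A n] has to be that of
    [rho (\1_(A n) * x)], which yields existence and uniqueness. Conditional
    expectations being local too, the two families whose essential suprema define
    the conjugates have the same [F]-measurable upper bounds. *)

Local Open Scope classical_set_scope.
Local Open Scope ring_scope.

(** * Existence, monotonicity and locality of conditional expectations given [F] *)

Section conditional_expectation.
Context {R : realType} {d : measure_display} {T : measurableType d}.
Variables (P : probability T R) (F : set (set T)).
Hypotheses (sigmaF : sigma_algebra setT F)
  (subF : F `<=` (measurable : set (set T))).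

Local Notation TF := (g_sigma_algebraType F).

Lemma g_measurableP (A : set TF) : measurable A <-> F A.
Proof. by rewrite (measurable_g_measurableTypeE sigmaF). Qed.

Lemma F_measurableW d' (U : measurableType d') (f : T -> U) :
  F_measurable F f -> measurable_fun setT f.
Proof.
by move=> mf _ Y mY; apply/subF/g_measurableP; exact: mf.
Qed.

Lemma measurable_id_g : measurable_fun setT (id : T -> TF).
Proof. by move=> _ Y mY; rewrite setTI; apply/subF/g_measurableP. Qed.

(* [distribution P idF] is the restriction of [P] to [F]. *)
Let idF : {mfun T >-> TF} := MeasurableFun.Pack
  (MeasurableFun.Class (isMeasurableFun.Build _ _ _ _ _ measurable_id_g)).

(** Radon-Nikodym: the charge sending [A] to the integral of [f] over [A], carried to [F], is
    absolutely continuous with respect to the restriction of [P] to [F]; its density is the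
    conditional expectation. *)
Lemma cond_exp_exists (f : T -> \bar R) : P.-integrable setT f ->
  exists g, is_cond_exp P F f g.
Proof.
move=> intf.
pose nu := pushforward (induced_charge intf) idF.
have nuP : nu `<< distribution P idF.
  apply/null_content_dominatesP => A mA PA0.
  have FA : measurable (A : set T) by exact/subF/g_measurableP.
  rewrite /nu/= /pushforward /induced_charge/=.
  apply: null_set_integral => //.
  exact: measurable_funTS (measurable_int _ intf).
pose RN := Radon_Nikodym nu (distribution P idF).
pose g := RN measurable_id_g.
have intg : (distribution P idF).-integrable setT g.
  exact: Radon_Nikodym_integrable.
have nug A : F A -> nu A = (\int[distribution P idF]_(x in A) g x)%E.
  by move=> FA; apply: Radon_Nikodym_integral => //; exact/g_measurableP.
exists g.
have mg : F_measurable F g by exact: measurable_int intg.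
have Pg : P.-integrable setT g.
  apply/integrableP; split; first exact: F_measurableW.
  move/integrableP : intg => [_]; rewrite ge0_integral_pushforward//.
  exact: measurableT_comp.
split => // A FA.
rewrite -[RHS]/(nu A) nug// integral_pushforward//.
  exact: integrableS measurableT (subF FA) _ Pg.
exact/g_measurableP.
Qed.

(** The part [B] of [A] where [g' < g] lies in [F], so the integral of [g - g'] over [B] is that of
    [f - f'], which is at most 0. Since [g - g'] is positive on [B], the set [B] is null. *)
Lemma is_cond_exp_le (A : set T) (f f' g g' : T -> \bar R) : F A ->
  P.-integrable setT f -> P.-integrable setT f' ->
  is_cond_exp P F f g -> is_cond_exp P F f' g' ->
  (forall w, A w -> (f w <= f' w)%E) ->
  \forall w \ae P, A w -> (g w <= g' w)%E.
Proof.
move=> FA intf intf' [mg intg gE] [mg' intg' g'E] ff'.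
pose B : set T := A `&` [set w | (g' w < g w)%E].
have FB : F B.
  apply/g_measurableP; apply: measurable_lte; first exact/g_measurableP.
  - by apply: measurable_funTS; exact: mg'.
  - by apply: measurable_funTS; exact: mg.
have mB : measurable B by exact: subF.
have intB h : P.-integrable setT h -> P.-integrable B h.
  exact: integrableS.
have gg'B w : B w -> (0 < g w - g' w)%E by case=> _ /=; rewrite sube_gt0.
have : (\int[P]_(w in B) `|g w - g' w| = 0)%E.
  apply/eqP; rewrite eq_le integral_ge0 ?andbT; last by move=> *; exact: abse_ge0.
  rewrite (eq_integral (fun w => g w - g' w)%E); last first.
    by move=> w /[!inE] Bw; rewrite gee0_abs// ltW// gg'B.
  rewrite integralB//; [|exact: intB..].
  rewrite gE// g'E// sube_le0; apply: le_integral => //; [exact: intB..|].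
  by move=> w /[!inE] -[Aw _]; exact: ff'.
have mgg' : measurable_fun B (fun w => g w - g' w)%E.
  apply: emeasurable_funB.
    by apply: measurable_funTS; exact: F_measurableW.
  by apply: measurable_funTS; exact: F_measurableW.
move/(ae_eq_integral_abs P mB mgg'); apply: filterS => w gg'0 Aw.
rewrite leNgt; apply/negP => g'g.
have Bw : B w by split.
by have := gg'B _ Bw; rewrite (gg'0 Bw) ltxx.
Qed.

Lemma is_cond_exp_eq (A : set T) (f f' g g' : T -> \bar R) : F A ->
  P.-integrable setT f -> P.-integrable setT f' ->
  is_cond_exp P F f g -> is_cond_exp P F f' g' ->
  (forall w, A w -> f w = f' w) ->
  \forall w \ae P, A w -> g w = g' w.
Proof.
move=> FA intf intf' fg fg' ff'.
have le1 : \forall w \ae P, A w -> (g w <= g' w)%E.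
  by apply: is_cond_exp_le fg fg' _ => // w Aw; rewrite ff'.
have le2 : \forall w \ae P, A w -> (g' w <= g w)%E.
  by apply: is_cond_exp_le fg' fg _ => // w Aw; rewrite ff'.
by apply: filterS2 le1 le2 => w le1 le2 Aw; apply/eqP; rewrite eq_le le1// le2.
Qed.

Lemma cond_exp1P (f : T -> \bar R) : P.-integrable setT f ->
  is_cond_exp P F f (cond_exp1 P F f).
Proof. by move=> intf; apply: xgetPex; exact: cond_exp_exists. Qed.

Lemma F_setT : F setT.
Proof. exact/g_measurableP/measurableT. Qed.

(** Convertible to the truncation written inside [cond_exp_nneg]. *)
Definition trunc (f : T -> \bar R) (n : nat) (w : T) : \bar R :=
  mine (f w) n%:R%:E.

(** * The generalized conditional expectation of a nonnegative variable *)

Section nonnegative.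
Variable f : T -> \bar R.
Hypotheses (mf : measurable_fun setT f) (f0 : forall w, (0 <= f w)%E).

Lemma trunc_ge0 n w : (0 <= trunc f n w)%E.
Proof. by rewrite /trunc le_min f0 lee_fin ler0n. Qed.

Lemma measurable_trunc n : measurable_fun setT (trunc f n).
Proof. exact: measurable_mine. Qed.

Lemma integrable_trunc n : P.-integrable setT (trunc f n).
Proof.
apply: (@le_integrable _ _ _ P setT _ (trunc f n) (cst n%:R%:E)) => //.
- exact: measurable_trunc.
- move=> w _; rewrite /= gee0_abs ?trunc_ge0// ger0_norm//.
  by rewrite /trunc ge_min lexx orbT.
- exact: finite_measure_integrable_cst.
Qed.

(** Versions are chosen separately for each [n], so each comparison of consecutive terms has its own
    null set; countably many of them are discarded together. *)
Lemma cond_exp1_trunc_nd : \forall w \ae P,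
  {homo (fun n => cond_exp1 P F (trunc f n) w) : n m / (n <= m)%N >-> (n <= m)%E}.
Proof.
have : \forall w \ae P, forall n,
    (cond_exp1 P F (trunc f n) w <= cond_exp1 P F (trunc f n.+1) w)%E.
  apply: ae_foralln => n.
  suff : \forall w \ae P, setT w ->
      (cond_exp1 P F (trunc f n) w <= cond_exp1 P F (trunc f n.+1) w)%E.
    by apply: filterS => w; exact.
  apply: (is_cond_exp_le F_setT _ _ (cond_exp1P (integrable_trunc n))
    (cond_exp1P (integrable_trunc n.+1))); [exact: integrable_trunc..|] => w _.
  by rewrite /trunc le_min ge_min lexx/= ge_min lee_fin ler_nat leqnSn orbT.
apply: filterS => w nd; apply: (@homo_leq _ _ (fun x y => (x <= y)%E)) => //.
by move=> x y z; exact: le_trans.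
Qed.

Lemma cond_exp1_trunc_le : \forall w \ae P, forall n,
  (cond_exp1 P F (trunc f n) w <= cond_exp_nneg P F f w)%E.
Proof.
apply: filterS cond_exp1_trunc_nd => w nd n.
have /cvg_lim := ereal_nondecreasing_cvgn nd.
rewrite /cond_exp_nneg => -> //.
by apply: ereal_sup_ubound; exists n.
Qed.

Lemma cond_exp1_trunc_ge0 n :
  \forall w \ae P, (0 <= cond_exp1 P F (trunc f n) w)%E.
Proof.
suff : \forall w \ae P, setT w -> (0 <= cond_exp1 P F (trunc f n) w)%E.
  by apply: filterS => w; exact.
apply: (is_cond_exp_le (f := cst 0%E) (g := cst 0%E)
  _ _ (integrable_trunc n) _ (cond_exp1P (integrable_trunc n))).
- exact: F_setT.
- exact: finite_measure_integrable_cst.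
- by split; [exact: measurable_cst|exact: finite_measure_integrable_cst|].
- by move=> w _; exact: trunc_ge0.
Qed.

Lemma cond_exp_nneg_ge0 : \forall w \ae P, (0 <= cond_exp_nneg P F f w)%E.
Proof.
apply: filterS2 cond_exp1_trunc_le (cond_exp1_trunc_ge0 0) => w le_n ge0.
exact: le_trans (le_n 0%N).
Qed.

(** Where the truncated versions are not monotone, [limn] may be a junk value. The upper limit is
    [F]-measurable on the whole space and agrees with [limn] off that null set. *)
Lemma cond_exp_nneg_measurable : exists2 g : T -> \bar R,
  F_measurable F g & \forall w \ae P, cond_exp_nneg P F f w = g w.
Proof.
exists (fun w => limn_esup (fun n => cond_exp1 P F (trunc f n) w)).
  apply: measurable_fun_limn_esup => n.
  by have [] := cond_exp1P (integrable_trunc n).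
apply: filterS cond_exp1_trunc_nd => w nd.
by rewrite is_cvg_limn_esupE//; exact: ereal_nondecreasing_is_cvgn.
Qed.

(** All truncated versions lie almost surely below the version for [f] itself, which is integrable
    and hence almost surely finite; so does their limit. *)
Lemma cond_exp_nneg_integrable : P.-integrable setT f ->
  exists2 z : T -> R, L0F F z &
    \forall w \ae P, cond_exp_nneg P F f w = (z w)%:E.
Proof.
move=> intf; have [g mg fg] := cond_exp_nneg_measurable.
exists (fine \o g); first exact: measurableT_comp.
have fy : \forall w \ae P, (cond_exp_nneg P F f w < +oo)%E.
  have [mh inth _] := cond_exp1P intf.
  have fh : \forall w \ae P, forall n,
      (cond_exp1 P F (trunc f n) w <= cond_exp1 P F f w)%E.
    apply: ae_foralln => n.
    suff : \forall w \ae P, setT w ->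
        (cond_exp1 P F (trunc f n) w <= cond_exp1 P F f w)%E.
      by apply: filterS => w; exact.
    apply: (is_cond_exp_le F_setT _ intf (cond_exp1P (integrable_trunc n))
      (cond_exp1P intf)); first exact: integrable_trunc.
    move=> w _.
    by rewrite /trunc ge_min lexx.
  apply: filterS3 cond_exp1_trunc_nd fh (integrable_ae measurableT inth).
  move=> w nd fh /(_ I) hfin.
  have /cvg_lim := ereal_nondecreasing_cvgn nd.
  rewrite /cond_exp_nneg => -> //.
  apply: (@le_lt_trans _ _ (cond_exp1 P F f w)); last by rewrite ltey_eq hfin.
  by apply: ge_ereal_sup => _ [n _ <-].
apply: filterS3 cond_exp_nneg_ge0 fy fg => w ge0 lty fgw.
by rewrite /= -fgw fineK// ge0_fin_numE.
Qed.

End nonnegative.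

(** Equality on [A] passes to every truncation, then to their conditional expectations on [A], then
    to the limit. *)
Lemma cond_exp_nneg_eq (A : set T) (f f' : T -> \bar R) : F A ->
  measurable_fun setT f -> (forall w, 0 <= f w)%E ->
  measurable_fun setT f' -> (forall w, 0 <= f' w)%E ->
  (forall w, A w -> f w = f' w) ->
  \forall w \ae P, A w -> cond_exp_nneg P F f w = cond_exp_nneg P F f' w.
Proof.
move=> FA mf f0 mf' f'0 ff'.
have : \forall w \ae P, forall n, A w ->
    cond_exp1 P F (trunc f n) w = cond_exp1 P F (trunc f' n) w.
  apply: ae_foralln => n; apply: (is_cond_exp_eq FA _ _
    (cond_exp1P (integrable_trunc mf f0 n))
    (cond_exp1P (integrable_trunc mf' f'0 n))); [exact: integrable_trunc..|].
  by move=> w Aw; rewrite /trunc ff'.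
apply: filterS => w eq_n Aw; rewrite /cond_exp_nneg.
by congr (limn _); apply/funext => n; exact: eq_n.
Qed.

Lemma cond_exp_eq (A : set T) (f f' : T -> \bar R) : F A ->
  measurable_fun setT f -> measurable_fun setT f' ->
  (forall w, A w -> f w = f' w) ->
  \forall w \ae P, A w -> cond_exp P F f w = cond_exp P F f' w.
Proof.
move=> FA mf mf' ff'.
have pos : \forall w \ae P, A w ->
    cond_exp_nneg P F f^\+%E w = cond_exp_nneg P F f'^\+%E w.
  apply: cond_exp_nneg_eq => //; [exact: measurable_funepos|
    exact: measurable_funepos|].
  by move=> w Aw; rewrite !funeposE ff'.
have neg : \forall w \ae P, A w ->
    cond_exp_nneg P F f^\-%E w = cond_exp_nneg P F f'^\-%E w.
  apply: cond_exp_nneg_eq => //; [exact: measurable_funeneg|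
    exact: measurable_funeneg|].
  by move=> w Aw; rewrite !funenegE ff'.
by apply: filterS2 pos neg => w pw nw Aw; rewrite /cond_exp (pw Aw) (nw Aw).
Qed.

(** The negative part is 0, but the version chosen for the zero function is known to vanish only
    almost surely. *)
Lemma cond_exp_ge0E (f : T -> \bar R) : measurable_fun setT f ->
  (forall w, 0 <= f w)%E ->
  \forall w \ae P, cond_exp P F f w = cond_exp_nneg P F f w.
Proof.
move=> mf f0.
have fp : f^\+%E = f.
  by apply/funext => w; rewrite funeposE; apply/max_idPl.
have fn : f^\-%E = cst 0%E.
  by apply/funext => w; rewrite funenegE; apply/max_idPr; rewrite oppe_le0.
have trunc0 n : trunc (cst 0%E) n = cst 0%E.
  by apply/funext => w; apply/min_idPl; rewrite lee_fin.
have int0 : P.-integrable setT (cst 0%E : T -> \bar R).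
  exact: finite_measure_integrable_cst.
have : \forall w \ae P, setT w -> cond_exp1 P F (cst 0%E) w = cst 0%E w.
  apply: (is_cond_exp_eq F_setT int0 int0 (cond_exp1P int0)) => //.
  by split => //; exact: measurable_cst.
apply: filterS => w /(_ I) c0; rewrite /cond_exp fp fn.
have -> : cond_exp_nneg P F (cst 0%E) w = 0%E.
  rewrite /cond_exp_nneg.
  rewrite (_ : (fun n => _) = cst 0%E) ?lim_cst//.
  by apply/funext => n; rewrite -[X in cond_exp1 P F X w]/(trunc _ _) trunc0.
by rewrite oppe0 DualAddTheoryNumDomain.dadde0.
Qed.

(** Turns a bound on the conditional expectation into genuine integrability on [A]: a truncation has
    the same integral over [A] as its conditional expectation, which lies below [z], hence below
    [k], almost surely on [A]. Monotone convergence then treats [f]. *)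
Lemma integral_cond_exp_le (A : set T) (f : T -> \bar R) (z : T -> R) (k : R) :
  F A -> measurable_fun setT f -> (forall w, 0 <= f w)%E ->
  (\forall w \ae P, cond_exp P F f w = (z w)%:E) ->
  (forall w, A w -> z w <= k) ->
  (\int[P]_(w in A) f w < +oo)%E.
Proof.
move=> FA mf f0 fz zk.
have mA := subF FA.
have trunc_nd w n m : (n <= m)%N -> (trunc f n w <= trunc f m w)%E.
  by move=> nm; rewrite /trunc le_min ge_min lexx/= ge_min lee_fin ler_nat nm orbT.
(* The sign of [k] is unknown; a nonnegative constant lets [P A <= 1] give a bound free of [A]. *)
suff bound n : (\int[P]_(w in A) trunc f n w <= `|k|%:E)%E.
  apply: (@le_lt_trans _ _ `|k|%:E); last exact: ltry.
  have -> : (\int[P]_(w in A) f w =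
             \int[P]_(w in A) limn (fun n => trunc f n w))%E.
    apply: eq_integral => w _; apply/esym/cvg_lim => //.
    rewrite /trunc; case: (f w) (f0 w) => [r r0|_|//].
    - apply: cvg_near_cst; near=> n; apply/min_idPl; rewrite lee_fin.
      by near: n; exact: nbhs_infty_ger.
    - rewrite (_ : (fun n => _) = (fun n : nat => n%:R%:E)); last first.
        by apply/funext => n; apply/min_idPr; rewrite leey.
      exact/cvgeryP/cvgr_idn.
  rewrite monotone_convergence//.
  - apply: lime_le; last by apply: nearW => n; exact: bound.
    apply: ereal_nondecreasing_is_cvgn => n m nm.
    apply: ge0_le_integral => //.
    + by move=> w _; exact: trunc_ge0.
    + by apply: measurable_funTS; exact: measurable_trunc.
    + by apply: measurable_funTS; exact: measurable_trunc.
    + by move=> w _; exact: trunc_nd.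
  - by move=> n; apply: measurable_funTS; exact: measurable_trunc.
  - by move=> n w _; exact: trunc_ge0.
  - by move=> w _ n m; exact: trunc_nd.
have [mg intg gE] := cond_exp1P (integrable_trunc mf f0 n).
rewrite -gE//.
have mgA : measurable_fun A (cond_exp1 P F (trunc f n)).
  by apply: measurable_funTS; exact: F_measurableW.
apply: (@le_trans _ _ (\int[P]_(w in A) cst `|k|%:E w)%E); last first.
  rewrite integral_cst// -[leRHS]mule1 lee_wpmul2l ?lee_fin//.
  exact: probability_le1.
(* The chosen version is nonnegative only almost surely, so its absolute value is integrated
   instead. *)
apply: le_trans (lee_abs _) _; apply: le_trans (le_abse_integral P mA mgA) _.
apply: ae_ge0_le_integral => //.
- exact: measurableT_comp.
- by move=> w _; rewrite lee_fin.
have zE : \forall w \ae P, cond_exp_nneg P F f w = (z w)%:E.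
  by apply: filterS2 fz (cond_exp_ge0E mf f0) => w <- ->.
apply: filterS3 zE (cond_exp1_trunc_ge0 mf f0 n) (cond_exp1_trunc_le mf f0).
move=> w zE g0 le_n Aw; rewrite gee0_abs//.
apply: le_trans (le_n n) _; rewrite zE lee_fin.
by rewrite (le_trans (zk _ Aw))// ler_norm.
Unshelve. all: by end_near.
Qed.

End conditional_expectation.

(** * Monotonicity, measurability and a midpoint estimate for Young functions *)

Section young.
Context {R : realType}.
Variable phi : R -> \bar R.
Hypothesis young_phi : young_function phi.

Lemma young_nd r s : r <= s -> (phi r <= phi s)%E.
Proof.
move=> rs; have [r0|r0] := leP 0 r; first exact: (young_nondecreasing young_phi).
rewrite (young_neg young_phi r0); have [s0|s0] := leP 0 s.
  exact: (young_ge0 young_phi).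
by rewrite (young_neg young_phi s0).
Qed.

Lemma young_nneg r : (0 <= phi r)%E.
Proof.
have [r0|r0] := leP 0 r; first exact: (young_ge0 young_phi).
by rewrite (young_neg young_phi r0).
Qed.

(** By monotonicity, the preimages of the closed half-lines generating the Borel sets are
    intervals. *)
Lemma measurable_young : measurable_fun setT phi.
Proof.
apply: (measurability (@ErealGenCInfty.G R)) => [|/= _ [_] [r] -> <-].
  exact: ErealGenCInfty.measurableE.
apply: measurableI => //; apply: is_interval_measurable => s t/=.
rewrite !in_itv/= !andbT => fs ft u /andP[su ut].
by rewrite in_itv/= andbT (le_trans fs)// young_nd.
Qed.

(** Convexity at the midpoint. The factors 1/2 on the right are dropped, as only finiteness of
    integrals will matter. *)
Lemma young_half a b :
  (phi (2^-1 * (a + b)) <= phi `|a| + phi `|b|)%E.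
Proof.
apply: (@le_trans _ _ (phi (2^-1 * `|a| + (1 - 2^-1) * `|b|))%E).
  apply: young_nd.
  have -> : 1 - 2^-1 = 2^-1 :> R by lra.
  by rewrite -mulrDr ler_wpM2l// (le_trans (ler_norm _))// ler_normD.
apply: le_trans (young_convex young_phi _ _ _ _) _; rewrite ?invr_ge0//.
  by rewrite invf_le1 ?ler1n.
have -> : 1 - 2^-1 = 2^-1 :> R by lra.
by apply: leeD; apply: gee_pMl; rewrite ?young_nneg ?lee_fin ?invf_le1 ?ler1n.
Qed.

End young.

(** * Closure properties of Orlicz spaces *)

Section orlicz.
Context {R : realType} {d : measure_display} {T : measurableType d}.
Variables (P : probability T R) (phi : R -> \bar R).
Hypothesis young_phi : young_function phi.

Lemma measurable_young_norm (e x : T -> R) :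
  measurable_fun setT e -> measurable_fun setT x ->
  measurable_fun setT (fun w => phi (e w * `|x w|)).
Proof.
move=> me mx; apply: measurableT_comp; first exact: measurable_young.
by apply: measurable_funM => //; exact: measurableT_comp.
Qed.

(** Covers sums, convex combinations and products with indicators at once. With [t] the smaller of
    the two rates, half of [t] is a rate for [z] by the midpoint estimate. *)
Lemma orlicz_dominated (x y z : T -> R) : L0 z ->
  orlicz P phi x -> orlicz P phi y ->
  (\forall w \ae P, `|z w| <= `|x w| + `|y w|) -> orlicz P phi z.
Proof.
move=> mz [mx [r r0 xr]] [my [s s0 ys]] zxy; split => //.
exists (2^-1 * Num.min r s); first by rewrite mulr_gt0// lt_min r0.
set t := Num.min r s.
have t0 : 0 < t by rewrite lt_min r0.
have mphi (u : T -> R) (c : R) : measurable_fun setT u ->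
    measurable_fun setT (fun w => phi (c * `|u w|)).
  by move=> mu; apply: measurable_young_norm.
have : (\int[P]_w (phi (r * `|x w|) + phi (s * `|y w|)) < +oo)%E.
  rewrite ge0_integralD//; [exact: lte_add_pinfty| | | |].
  - by move=> w _; exact: young_nneg.
  - exact: mphi.
  - by move=> w _; exact: young_nneg.
  - exact: mphi.
apply: le_lt_trans; apply: ae_ge0_le_integral => //.
- by move=> w _; exact: young_nneg.
- exact: mphi.
- by move=> w _; apply: adde_ge0; exact: young_nneg.
- by apply: emeasurable_funD; exact: mphi.
apply: filterS zxy => w zxy _.
apply: (@le_trans _ _ (phi (2^-1 * (t * `|x w| + t * `|y w|)))).
  by apply: young_nd => //; rewrite -mulrA ler_wpM2l// -mulrDr ler_wpM2l// ltW.
apply: le_trans (young_half young_phi _ _) _.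
rewrite !normrM !normr_id (gtr0_norm t0).
by apply: leeD; apply: young_nd => //; rewrite ler_wpM2r// ge_min lexx ?orbT.
Qed.

Lemma orlicz_bounded (x : T -> R) (c : R) : L0 x ->
  (forall w, `|x w| <= c) -> orlicz P phi x.
Proof.
move=> mx xc; split => //.
have [e e0 fine_e] := young_finite_near0 young_phi.
have c0 : 0 <= `|c| by [].
(* This makes [r * (|c| + 1)] equal to [e / 2], strictly inside the range where [phi] is finite;
   adding 1 avoids dividing by 0. *)
pose r := e / 2 / (`|c| + 1).
have r0 : 0 < r by rewrite !divr_gt0// ltr_wpDl.
exists r => //.
apply: (@le_lt_trans _ _ (\int[P]_w (cst (phi (e / 2)) w))%E).
  apply: ge0_le_integral => //.
  - by move=> w _; exact: young_nneg.
  - by apply: (@measurable_young_norm (cst r)).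
  move=> w _; apply: young_nd => //.
  rewrite -[leRHS](@divfK _ (`|c| + 1)) ?gt_eqF// ?ltr_wpDl//.
  rewrite ler_wpM2l// ?(ltW r0)//.
  by rewrite (le_trans (xc w))// (le_trans (ler_norm _))// lerDl.
rewrite integral_cst// [X in (_ * X)%E]probability_setT mule1.
apply: fine_e; first by rewrite divr_ge0// ltW.
by rewrite ltr_pdivrMr// mulr_natr mulr2n ltrDl.
Qed.

End orlicz.

(** * Locality of risk measures, and exhaustions by sets of [F] *)

Section localization.
Context {R : realType} {d : measure_display} {T : measurableType d}.
Variables (P : probability T R) (F : set (set T)).
Hypotheses (sigmaF : sigma_algebra setT F)
  (subF : F `<=` (measurable : set (set T))).

Lemma LinftyF_bounded (eta : T -> R) (c : R) : L0F F eta ->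
  (\forall w \ae P, `|eta w| <= c) -> LinftyF P F eta.
Proof.
move=> mF etac; split => //.
apply/andP; split; rewrite inE /=.
  exact: (F_measurableW sigmaF subF).
rewrite /finite_norm unlock; case: ifP => // _.
apply: (@le_lt_trans _ _ c%:E); last exact: ltry.
by apply/ess_sup_inf.ess_supP; apply: filterS etac => w /=; rewrite lee_fin.
Qed.

Lemma L0F_indic (A : set T) : F A -> L0F F (\1_A : T -> R).
Proof. by move=> FA; apply: measurable_indic; exact/g_measurableP. Qed.

Lemma indic_mulE (A : set T) (x : T -> R) w : A w -> \1_A w * x w = x w.
Proof. by move=> Aw; rewrite indicE mem_set// mul1r. Qed.

(** If [u = v] on [A], then [u] is the combination of [v] and [u] with coefficient [\1_A], so
    convexity bounds [rho u] by [rho v] on [A]; then exchange the roles. Keeping [X] and [C] general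
    lets this serve both kinds of risk measure. *)
Lemma crm_local (X C : set (T -> R)) (rho : (T -> R) -> (T -> R))
    (A : set T) (x y : T -> R) :
  cond_risk_measure P F X C rho -> C \1_A -> X x -> X y ->
  (forall w, A w -> x w = y w) ->
  \forall w \ae P, A w -> rho x w = rho y w.
Proof.
move=> crm CA.
have indic01 : \forall w \ae P, 0 <= (\1_A : T -> R) w <= 1.
  by apply: aeW => w; rewrite indicE; case: (w \in A); rewrite !lexx !ler01.
suff le_local u v : X u -> X v -> (forall w, A w -> u w = v w) ->
    \forall w \ae P, A w -> rho u w <= rho v w.
  move=> Xx Xy xy.
  have yx w : A w -> y w = x w by move=> Aw; rewrite xy.
  apply: filterS2 (le_local _ _ Xx Xy xy) (le_local _ _ Xy Xx yx) => w le1 le2 Aw.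
  by apply/eqP; rewrite eq_le le1// le2.
move=> Xu Xv uv; apply: filterS (crm_convex crm Xv Xu CA indic01) => w + Aw.
rewrite (_ : (fun v0 => _) = u); last first.
  apply/funext => w'; rewrite indicE.
  have [/set_mem/uv ->|_] := boolP (w' \in A); last first.
    by rewrite mul0r subr0 mul1r add0r.
  by rewrite mul1r subrr mul0r addr0.
by rewrite indicE mem_set// mul1r subrr mul0r addr0.
Qed.

(** Membership for all large [n], rather than for some [n], makes the notion stable under termwise
    intersection without requiring monotone sequences. *)
Definition exhausts (A : nat -> set T) : Prop :=
  (forall n, F (A n)) /\ \forall w \ae P, \forall n \near \oo, A n w.

Lemma exhaustsI (A B : nat -> set T) : exhausts A -> exhausts B ->
  exhausts (fun n => A n `&` B n).
Proof.
move=> [FA Ae] [FB Be]; split.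
  by move=> n; apply/(g_measurableP sigmaF)/measurableI; exact/(g_measurableP sigmaF).
by apply: filterS2 Ae Be => w; exact: filterS2.
Qed.

Lemma ae_exhausts (A : nat -> set T) (Q : T -> Prop) : exhausts A ->
  (forall n, \forall w \ae P, A n w -> Q w) -> \forall w \ae P, Q w.
Proof.
move=> [_ Ae] /ae_foralln AQ; apply: filterS2 Ae AQ => w Aw AQ.
by have [n /AQ] := filter_ex Aw.
Qed.

Lemma exhausts_le_nat (eta : T -> R) : L0F F eta ->
  exhausts (fun n => [set w | eta w <= n%:R]).
Proof.
move=> meta; split; last first.
  by apply: aeW => w; near=> n => /=; near: n; exact: nbhs_infty_ger.
move=> n; apply/(g_measurableP sigmaF).
rewrite -[X in measurable X]setTI.
by apply: (@measurable_fun_le _ _ _ setT) => //; exact: measurable_cst.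
Unshelve. all: by end_near. Qed.

(** * The conditional Orlicz space as a localization of the Orlicz space *)

Variable phi : R -> \bar R.
Hypothesis young_phi : young_function phi.

(** The constant rate [r] serves as [eta]: an integrable nonnegative variable has an almost surely
    finite conditional expectation. *)
Lemma orlicz_cond_orlicz : orlicz P phi `<=` cond_orlicz P F phi.
Proof.
move=> x [mx [r r0 phix]]; split => //.
have mf : measurable_fun setT (fun w => phi (r * `|x w|)).
  exact: (measurable_young_norm young_phi (@measurable_cst _ _ _ _ setT r)).
have f0 w : (0 <= phi (r * `|x w|))%E by exact: young_nneg.
have intf : P.-integrable setT (fun w => phi (r * `|x w|)).
  apply/integrableP; split => //.
  by under eq_integral do rewrite gee0_abs//.
have [z mz fz] := cond_exp_nneg_integrable sigmaF subF mf f0 intf.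
exists (cst r), z; split => //.
  by split; [exact: measurable_cst|exact: aeW].
have fE := cond_exp_ge0E P sigmaF subF mf f0.
by apply: filterS2 fz fE => w <- -> _.
Qed.

Lemma orlicz_indic (A : set T) (x : T -> R) : F A -> orlicz P phi x ->
  orlicz P phi (fun w => \1_A w * x w).
Proof.
move=> FA xL; have [mx _] := xL.
apply: (orlicz_dominated young_phi _ xL xL).
  by apply: measurable_funM => //; apply: measurable_indic; exact: subF.
apply: aeW => w; rewrite indicE.
by case: (w \in A); rewrite ?mul1r ?mul0r ?normr0 ?lerDl ?addr_ge0.
Qed.

(** On [A n], the rate [1 / (n + 1)] is at most [eta], and [phi (eta |x|)] has a finite integral
    over [A n] because [z] is bounded there. Off [A n] the integrand is [phi 0 = 0]. *)
Lemma cond_orlicz_exhausts (x : T -> R) : cond_orlicz P F phi x ->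
  exists2 A, exhausts A & forall n, orlicz P phi (fun w => \1_(A n) w * x w).
Proof.
move=> [mx [eta [z [[meta eta0] mz fz]]]].
pose B n := [set w | z w <= n%:R].
(* The shift by one keeps this level positive at [n = 0]; it is reused below as the rate for
   [\1_(A n) * x]. *)
pose B' n := [set w | n.+1%:R^-1 <= eta w].
have exB' : exhausts B'.
  split.
    move=> n; apply/(g_measurableP sigmaF); rewrite -[X in measurable X]setTI.
    by apply: (@measurable_fun_le _ _ _ setT) => //; exact: measurable_cst.
  apply: filterS eta0 => w eta0; near=> n => /=; apply: ltW.
  by near: n; exact: near_infty_natSinv_lt (PosNum eta0).
have exA := exhaustsI (exhausts_le_nat mz) exB'.
exists (fun n => B n `&` B' n) => // n.
set A := B n `&` B' n.
have FA : F A by have [+ _] := exA; exact.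
have mA : measurable_fun setT (\1_A : T -> R) by apply: measurable_indic; exact: subF.
split; first exact: measurable_funM.
exists n.+1%:R^-1 => //.
pose f w := phi (eta w * `|x w|).
have mf : measurable_fun setT f.
  by apply: measurable_young_norm => //; exact: (F_measurableW sigmaF subF meta).
have f0 w : (0 <= f w)%E by exact: young_nneg.
have fzE : \forall w \ae P, cond_exp P F f w = (z w)%:E.
  by apply: filterS fz => w; exact.
have zn w : A w -> z w <= n%:R by case.
apply: le_lt_trans (integral_cond_exp_le sigmaF subF FA mf f0 fzE zn).
rewrite [leRHS]integral_mkcond; apply: ge0_le_integral => //.
- by move=> w _; exact: young_nneg.
- apply: (measurable_young_norm young_phi (@measurable_cst _ _ _ _ setT _)).
  exact: measurable_funM.
- by apply/(measurable_restrictT f (subF FA)); exact: measurable_funTS.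
move=> w _; rewrite indicE /patch; case: ifPn => [/set_mem [_ /= etan]|_].
  by rewrite mul1r; apply: young_nd => //; rewrite ler_wpM2r.
by rewrite mul0r normr0 mulr0 (young0 young_phi).
Unshelve. all: by end_near. Qed.

(** * Construction of the extension by gluing *)

Variable rho : (T -> R) -> (T -> R).
Hypothesis crm_rho : cond_risk_measure P F (orlicz P phi) (LinftyF P F) rho.

Lemma LinftyF_indic (A : set T) : F A -> LinftyF P F (\1_A : T -> R).
Proof.
move=> FA; apply: (@LinftyF_bounded _ 1); first exact: L0F_indic.
by apply: aeW => w; rewrite indicE; case: (w \in A); rewrite ?normr1 ?normr0.
Qed.

(** Quantifying over all pairs [A], [x'] makes the condition independent of any particular
    exhaustion. *)
Definition local_extension (x g : T -> R) : Prop := L0F F g /\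
  forall A x', F A -> orlicz P phi x' -> (forall w, A w -> x' w = x w) ->
    \forall w \ae P, A w -> g w = rho x' w.

(** The default [cst 0] is taken only if no such [g] exists, which does not happen on the
    conditional Orlicz space. *)
Definition crm_extension (x : T -> R) : T -> R :=
  xget (cst 0) [set g | local_extension x g].

(** Locality of [rho] makes the values [rho (x_ n)] on [A n] compatible. Arbitrary approximants [x_]
    are allowed, so that convex combinations and translates can be treated directly through
    approximants adapted to them. *)
Lemma local_extension_exists (A : nat -> set T) (x_ : nat -> T -> R)
    (x : T -> R) : exhausts A -> (forall n, orlicz P phi (x_ n)) ->
  (forall n w, A n w -> x_ n w = x w) -> local_extension x (crm_extension x).
Proof.
move=> exA x_L x_x; have [FA Ae] := exA.
apply: (@xgetPex _ (cst 0) [set g | local_extension x g]).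
(* Almost everywhere [rho (x_ n) w] is eventually constant in [n]; the upper limit
   is used because it is [F]-measurable without any exceptional set. *)
exists (fine \o (fun w => limn_esup (fun n => (rho (x_ n) w)%:E))); split.
  apply: measurableT_comp => //; apply: measurable_fun_limn_esup => n.
  by apply/measurable_EFinP; exact: (crm_L0F crm_rho).
move=> B x' FB x'L x'x.
have : \forall w \ae P, forall n, A n w -> B w -> rho (x_ n) w = rho x' w.
  apply: ae_foralln => n.
  have FAB : F (A n `&` B).
    by apply/(g_measurableP sigmaF)/measurableI; exact/(g_measurableP sigmaF).
  have : \forall w \ae P, (A n `&` B) w -> rho (x_ n) w = rho x' w.
    apply: (crm_local crm_rho (LinftyF_indic FAB)) => // w [Aw Bw].
    by rewrite x_x// x'x.
  by apply: filterS => w h Aw Bw; exact: h.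
apply: filterS2 Ae => w Aw rhoE Bw /=.
have cvg_rho : (rho (x_ n) w)%:E @[n --> \oo] --> (rho x' w)%:E.
  apply: cvg_near_cst; apply: filterS Aw => n Anw; by rewrite rhoE.
rewrite is_cvg_limn_esupE; last by apply/cvg_ex; exists (rho x' w)%:E.
by rewrite (cvg_lim _ cvg_rho).
Qed.

Lemma cond_orlicz_local_extension (x : T -> R) : cond_orlicz P F phi x ->
  local_extension x (crm_extension x).
Proof.
case/cond_orlicz_exhausts => A exA xL.
by apply: (local_extension_exists exA xL) => n w; exact: indic_mulE.
Qed.

(** Intersect two exhaustions: a further indicator does not leave the Orlicz space. *)
Lemma cond_orlicz_exhausts2 (x y : T -> R) :
  cond_orlicz P F phi x -> cond_orlicz P F phi y ->
  exists A, [/\ exhausts A, forall n, orlicz P phi (fun w => \1_(A n) w * x w)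
    & forall n, orlicz P phi (fun w => \1_(A n) w * y w)].
Proof.
move=> /cond_orlicz_exhausts[A exA xL] /cond_orlicz_exhausts[B exB yL].
exists (fun n => A n `&` B n); split; first exact: exhaustsI.
- move=> n; rewrite (_ : (fun w => _) = (fun w => \1_(B n) w * (\1_(A n) w * x w))).
    by apply: orlicz_indic => //; have [+ _] := exB; exact.
  by apply/funext => w; rewrite indicI /= mulrA [X in X * _]mulrC.
- move=> n; rewrite (_ : (fun w => _) = (fun w => \1_(A n) w * (\1_(B n) w * y w))).
    by apply: orlicz_indic => //; have [+ _] := exA; exact.
  by apply/funext => w; rewrite indicI /= mulrA.
Qed.

(** * The axioms of a risk measure for the extension, each inherited from [rho] on the sets of an
    exhaustion *)

Lemma crm_extension_monotone (x y : T -> R) :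
  cond_orlicz P F phi x -> cond_orlicz P F phi y ->
  (\forall w \ae P, x w <= y w) ->
  \forall w \ae P, crm_extension y w <= crm_extension x w.
Proof.
move=> xL yL xy; have [_ ex] := cond_orlicz_local_extension xL.
have [_ ey] := cond_orlicz_local_extension yL.
have [A [exA AxL AyL]] := cond_orlicz_exhausts2 xL yL.
apply: (ae_exhausts exA) => n; have [FA _] := exA.
have exn := ex _ _ (FA n) (AxL n) (@indic_mulE _ _).
have eyn := ey _ _ (FA n) (AyL n) (@indic_mulE _ _).
have Axy : \forall w \ae P, \1_(A n) w * x w <= \1_(A n) w * y w.
  by apply: filterS xy => w xy; rewrite ler_wpM2l// indicE.
have mono := crm_monotone crm_rho (AxL n) (AyL n) Axy.
by apply: filterS3 exn eyn mono => w exn eyn mono Aw; rewrite exn// eyn.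
Qed.

(** A coefficient between 0 and 1 is already in [LinftyF], so convexity of [rho] applies with the
    same [lam] to the localized variables; their combination [z_ n] is dominated by the sum of their
    absolute values. *)
Lemma crm_extension_convex (x y lam : T -> R) :
  cond_orlicz P F phi x -> cond_orlicz P F phi y -> L0F F lam ->
  (\forall w \ae P, 0 <= lam w <= 1) ->
  \forall w \ae P, crm_extension (fun v => lam v * x v + (1 - lam v) * y v) w <=
    lam w * crm_extension x w + (1 - lam w) * crm_extension y w.
Proof.
move=> xL yL mlam lam01; have [_ ex] := cond_orlicz_local_extension xL.
have [_ ey] := cond_orlicz_local_extension yL.
have [A [exA AxL AyL]] := cond_orlicz_exhausts2 xL yL.
set z := fun v => lam v * x v + _.
pose z_ n v := lam v * (\1_(A n) v * x v) + (1 - lam v) * (\1_(A n) v * y v).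
have z_z n w : A n w -> z_ n w = z w by move=> Aw; rewrite /z_ !indic_mulE.
have mlamT : measurable_fun setT lam by exact: (F_measurableW sigmaF subF mlam).
have z_L n : orlicz P phi (z_ n).
  have [mx _] := AxL n; have [my _] := AyL n.
  apply: (orlicz_dominated young_phi _ (AxL n) (AyL n)).
    apply: measurable_funD; apply: measurable_funM => //.
    exact: measurable_funB.
  apply: filterS lam01 => w /andP[lam0 lam1].
  apply: le_trans (ler_normD _ _) _; rewrite (normrM (lam w)) (normrM (1 - _)).
  rewrite (ger0_norm lam0) (@ger0_norm _ (1 - lam w)) ?subr_ge0//.
  by apply: lerD; rewrite ler_piMl// gerBl.
have [_ ez] := local_extension_exists exA z_L z_z.
apply: (ae_exhausts exA) => n; have [FA _] := exA.
have exn := ex _ _ (FA n) (AxL n) (@indic_mulE _ _).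
have eyn := ey _ _ (FA n) (AyL n) (@indic_mulE _ _).
have ezn := ez _ _ (FA n) (z_L n) (@z_z n).
have lamL : LinftyF P F lam.
  apply: (@LinftyF_bounded _ 1) => //.
  by apply: filterS lam01 => w /andP[lam0]; rewrite ger0_norm.
have conv := crm_convex crm_rho (AxL n) (AyL n) lamL lam01.
have exyn : \forall w \ae P, A n w ->
    crm_extension x w = rho (fun w => \1_(A n) w * x w) w /\
    crm_extension y w = rho (fun w => \1_(A n) w * y w) w.
  by apply: filterS2 exn eyn => w + + Aw => -> // ->.
by apply: filterS3 exyn ezn conv => w + + conv Aw => -[]// -> -> ->.
Qed.

(** As [eta] may be unbounded, the exhaustion for [x] is intersected with the sets where
    [|eta| <= n]. There [eta] agrees with the bounded [e_ n], to which cash invariance of [rho]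
    applies. *)
Lemma crm_extension_cash_invariant (x eta : T -> R) :
  cond_orlicz P F phi x -> L0F F eta ->
  \forall w \ae P,
    crm_extension (fun v => x v + eta v) w = crm_extension x w - eta w.
Proof.
move=> xL meta; have [_ ex] := cond_orlicz_local_extension xL.
have [B exB BxL] := cond_orlicz_exhausts xL.
have mabs : L0F F (fun w => `|eta w|) by exact: measurableT_comp.
pose C n := [set w | `|eta w| <= n%:R].
have exC : exhausts C by exact: exhausts_le_nat.
pose A n := B n `&` C n.
have exA : exhausts A by exact: exhaustsI.
have [FA _] := exA; have [FC _] := exC.
pose e_ n w := \1_(C n) w * eta w.
have me_ n : L0F F (e_ n) by apply: measurable_funM => //; exact: L0F_indic.
have e_n n w : `|e_ n w| <= n%:R.
  rewrite /e_ indicE; have [/set_mem|] := boolP (w \in C n); rewrite ?mul1r//.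
  by rewrite mul0r normr0.
have e_Loo n : LinftyF P F (e_ n).
  by apply: LinftyF_bounded => //; apply: aeW; exact: e_n.
have e_L n : orlicz P phi (e_ n).
  by apply: (orlicz_bounded P young_phi _ (e_n n)); exact: (F_measurableW sigmaF subF (me_ n)).
pose x_ n v := \1_(B n) v * x v.
have x_x n w : A n w -> x_ n w = x w by case=> Bw _; rewrite /x_ indic_mulE.
have xe_L n : orlicz P phi (fun v => x_ n v + e_ n v).
  have [mx _] := BxL n; have [me _] := e_L n.
  apply: (orlicz_dominated young_phi _ (BxL n) (e_L n)).
    exact: measurable_funD.
  by apply: aeW => w; exact: ler_normD.
have xe_xe n w : A n w -> x_ n w + e_ n w = x w + eta w.
  by move=> Aw; rewrite x_x// /e_ indic_mulE//; case: Aw.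
have [_ exe] := local_extension_exists exA xe_L xe_xe.
apply: (ae_exhausts exA) => n.
have exn := ex _ _ (FA n) (BxL n) (@x_x n).
have exen := exe _ _ (FA n) (xe_L n) (@xe_xe n).
have cash := crm_cash_invariant crm_rho (BxL n) (e_Loo n).
apply: filterS3 exn exen cash => w exn exen /(_ I) cash Aw.
rewrite exen// exn//; apply: etrans cash _.
by rewrite /e_ indic_mulE//; case: Aw.
Qed.

Lemma crm_extension_crm :
  cond_risk_measure P F (cond_orlicz P F phi) (L0F F) crm_extension.
Proof.
split.
- by move=> x /cond_orlicz_local_extension[].
- move=> x y xL yL xy.
  have le_xy : \forall w \ae P, x w <= y w by apply: filterS xy => w ->.
  have le_yx : \forall w \ae P, y w <= x w by apply: filterS xy => w ->.
  apply: filterS2 (crm_extension_monotone xL yL le_xy)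
    (crm_extension_monotone yL xL le_yx) => w le1 le2 _.
  by apply/eqP; rewrite eq_le le2.
- exact: crm_extension_monotone.
- exact: crm_extension_convex.
- move=> x eta xL meta.
  by apply: filterS (crm_extension_cash_invariant xL meta) => w.
Qed.

(** * Extension property, uniqueness and conjugates *)

Lemma crm_extensionE (x : T -> R) : orlicz P phi x ->
  \forall w \ae P, crm_extension x w = rho x w.
Proof.
move=> xL.
have [_ ex] := cond_orlicz_local_extension (orlicz_cond_orlicz xL).
by apply: filterS (ex setT x (F_setT sigmaF) xL _) => // w; exact.
Qed.

(** Indicators of sets of [F] are in [L0F], so [rho'] is local too: on [A n] its value at [x] is its
    value at [\1_(A n) * x], which is prescribed by [rho]. *)
Lemma crm_extension_unique (rho' : (T -> R) -> (T -> R)) :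
  cond_risk_measure P F (cond_orlicz P F phi) (L0F F) rho' ->
  (forall x, orlicz P phi x -> rho' x = rho x %[ae P]) ->
  forall x, cond_orlicz P F phi x ->
    \forall w \ae P, rho' x w = crm_extension x w.
Proof.
move=> crm' rho'E x xL; have [_ ex] := cond_orlicz_local_extension xL.
have [A exA AxL] := cond_orlicz_exhausts xL; have [FA _] := exA.
apply: (ae_exhausts exA) => n.
have exn := ex _ _ (FA n) (AxL n) (@indic_mulE _ _).
have loc : \forall w \ae P, A n w ->
    rho' (fun w => \1_(A n) w * x w) w = rho' x w.
  have AxL' : cond_orlicz P F phi (fun w => \1_(A n) w * x w).
    exact: orlicz_cond_orlicz.
  exact: crm_local crm' (L0F_indic (FA n)) AxL' xL (@indic_mulE _ _).
apply: filterS3 exn loc (rho'E _ (AxL n)) => w exn loc /(_ I) rho'E' Aw.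
by rewrite exn// -loc// rho'E'.
Qed.

(* Both sides choose from the same set, so the existence of an essential supremum
   plays no role. *)
Lemma eq_ess_sup_family (S S' : set (T -> \bar R)) :
  (forall h, F_measurable F h ->
    (forall f, S f -> \forall w \ae P, (f w <= h w)%E) <->
    (forall f, S' f -> \forall w \ae P, (f w <= h w)%E)) ->
  ess_sup_family P F S = ess_sup_family P F S'.
Proof.
move=> SS'; rewrite /ess_sup_family; congr xget; apply/seteqP.
by split => g [mg ub least]; split => // [|h mh hub];
  [exact/(SS' _ mg)|apply: least => //; exact/(SS' _ mh)|
   exact/(SS' _ mg)|apply: least => //; exact/(SS' _ mh)].
Qed.

(** An upper bound for the larger family bounds the smaller one by inclusion of the Orlicz spaces.
    Conversely, on [A n] the member given by [x] coincides almost surely with the one given by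
    [\1_(A n) * x], since both the conditional expectation and the extension are local. *)
Lemma crm_conjugate_extension (y : T -> R) : L0 y ->
  crm_conjugate P F (cond_orlicz P F phi) crm_extension y =
  crm_conjugate P F (orlicz P phi) rho y.
Proof.
move=> my; apply: eq_ess_sup_family => h mh; split => ub _ [x xL <-].
  have := ub _ (imageP _ (orlicz_cond_orlicz xL)).
  by apply: filterS2 (crm_extensionE xL) => w ->.
have [_ ex] := cond_orlicz_local_extension xL.
have [A exA AxL] := cond_orlicz_exhausts xL; have [FA _] := exA.
apply: (ae_exhausts exA) => n.
have exn := ex _ _ (FA n) (AxL n) (@indic_mulE _ _).
have ubn : \forall w \ae P,
    (cond_exp P F (fun v => (\1_(A n) v * x v * y v)%:E) w -
     (rho (fun v => \1_(A n) v * x v) w)%:E <= h w)%E.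
  by have := ub _ (imageP _ (AxL n)).
have [mx _] := xL; have [mAx _] := AxL n.
have cexn : \forall w \ae P, A n w ->
    cond_exp P F (fun v => (x v * y v)%:E) w =
    cond_exp P F (fun v => (\1_(A n) v * x v * y v)%:E) w.
  apply: (cond_exp_eq P sigmaF subF (FA n)).
  - by apply/measurable_EFinP; exact: measurable_funM.
  - by apply/measurable_EFinP; exact: measurable_funM.
  - by move=> w Aw; rewrite indic_mulE.
apply: filterS3 exn cexn ubn => w exn cexn ubn Aw.
rewrite (exn Aw) (cexn Aw).
exact: ubn.
Qed.

End localization.

Theorem proposition6p5 (R : realType) (d : measure_display)
    (T : measurableType d) (P : probability T R)
    (F : set (set T)) (sigmaF : sigma_algebra setT F)
    (subF : F `<=` (measurable : set (set T)))
    (phi : R -> \bar R) (young_phi : young_function phi)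
    (rho : (T -> R) -> (T -> R))
    (crm_rho : cond_risk_measure P F (orlicz P phi) (LinftyF P F) rho) :
  exists rhobar : (T -> R) -> (T -> R),
    [/\ cond_risk_measure P F (cond_orlicz P F phi) (L0F F) rhobar,
        (forall x, orlicz P phi x -> rhobar x = rho x %[ae P]),
        (forall rho' : (T -> R) -> (T -> R),
           cond_risk_measure P F (cond_orlicz P F phi) (L0F F) rho' ->
           (forall x, orlicz P phi x -> rho' x = rho x %[ae P]) ->
           forall x, cond_orlicz P F phi x -> rho' x = rhobar x %[ae P])
      & (forall y, orlicz P (young_conjugate phi) y ->
           crm_conjugate P F (cond_orlicz P F phi) rhobar y =
           crm_conjugate P F (orlicz P phi) rho y %[ae P])].
Proof.
exists (crm_extension P F phi rho); split.
- exact: crm_extension_crm.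
- by move=> x xL; apply: filterS (crm_extensionE sigmaF subF young_phi crm_rho xL).
- move=> rho' crm' rho'E x xL.
  by apply: filterS (crm_extension_unique sigmaF subF young_phi crm_rho crm' rho'E xL).
- move=> y [my _]; apply: aeW => w _.
  by rewrite (crm_conjugate_extension sigmaF subF young_phi crm_rho my).
Qed.
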